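(* Let $F:\mathbb C^6\to\mathbb C$, $(a_0,a_1,a_2,a_3,a_4,x)\mapsto x^5 + a_4x^4 + a_3x^3 + a_2x^2 + a_1 x + a_0$. Then there is no continuous function $r:\mathbb R^5\to\mathbb C$ such that $F(M,r(M))=0$ for all $M=(a_0,a_1,a_2,a_3,a_4)\in\mathbb R^5$.
   Context: Here $F(M,x)$ with $M=(a_0,a_1,a_2,a_3,a_4)$ means $F(a_0,a_1,a_2,a_3,a_4,x)$. Continuity is with respect to the standard topologies of $\mathbb R^5$ and $\mathbb C$. *)

(* Defs.v *)
(* Stdlib's real numbers with Coquelicot's complex numbers and topology. *)
From Stdlib Require Import Reals.
From Coquelicot Require Import Coquelicot.

(* Nested pairs associate to the left, so that for [M : C5] the pair [(M, x)]
   is literally the 6-tuple (a0, a1, a2, a3, a4, x). *)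
Definition R5 : Type := (R * R * R * R * R)%type.
Definition C5 : Type := (C * C * C * C * C)%type.
Definition C6 : Type := (C * C * C * C * C * C)%type.

Definition F (p : C6) : C :=
  let '(a0, a1, a2, a3, a4, x) := p in
  (x ^ 5 + a4 * x ^ 4 + a3 * x ^ 3 + a2 * x ^ 2 + a1 * x + a0)%C.

Definition R5_to_C5 (M : R5) : C5 :=
  let '(a0, a1, a2, a3, a4) := M in
  (RtoC a0, RtoC a1, RtoC a2, RtoC a3, RtoC a4).

(* Product (sup-norm) uniform structure, which induces the standard topology. *)
Definition R5_UniformSpace : UniformSpace :=
  prod_UniformSpace
    (prod_UniformSpace
      (prod_UniformSpace
        (prod_UniformSpace R_UniformSpace R_UniformSpace)
        R_UniformSpace)
      R_UniformSpace)
    R_UniformSpace.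

(* [C_UniformSpace] is the product structure on [C = R * R]. *)
Definition continuous_R5_C (r : R5 -> C) : Prop :=
  forall M : R5, @continuous R5_UniformSpace C_UniformSpace r M.

(* Main.v *)
Require Import Defs.
From Stdlib Require Import Reals Lra.
From Coquelicot Require Import Coquelicot.

(** Let [r] be a continuous root and follow it along paths of quintics whose
    roots are known.  The four nonreal roots of
    [x ((x - 4i)^2 - 9 e^(it)) ((x + 4i)^2 - 9 e^(-it))] are swapped in pairs as
    [t] runs through [0, 2 pi], so at [t = 0], where the roots are
    [0], [3 +- 4i], [-3 +- 4i], the value of [r] must be [0].  Keep [0] as a root
    and let the pair [-3 +- 4i] collide on the real axis and split into [-4], [-2]:
    then [r] becomes the largest of three real roots.  Letting instead [3 +- 4i]
    become [2], [4] makes [r] the smallest of three.  But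
    the two end points are joined by a path along which the three real roots stay
    distinct, so [r] would keep its rank. *)

Open Scope R_scope.

Definition continuous_root (r : R5 -> C) : Prop :=
  continuous_R5_C r /\ forall M : R5, F (R5_to_C5 M, r M) = RtoC 0.

(** * Continuity and signs along real paths of coefficients *)

Lemma R5_ext (a0 a1 a2 a3 a4 b0 b1 b2 b3 b4 : R) :
  a0 = b0 -> a1 = b1 -> a2 = b2 -> a3 = b3 -> a4 = b4 ->
  (a0, a1, a2, a3, a4) = (b0, b1, b2, b3, b4) :> R5.
Proof. now intros; subst. Qed.

(** Intermediate value theorem. This is how a root is tracked: a function that vanishes at none of
    the possible roots keeps its sign along the path. *)
Lemma positive_of_nonvanishing (f : R -> R) (a b : R) :
  continuity f -> a <= b -> (forall t, a <= t <= b -> f t <> 0) ->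
  0 < f a -> 0 < f b.
Proof.
  intros Hf Hab Hnz Ha.
  destruct (Rlt_or_le 0 (f b)) as [Hb | Hb]; [exact Hb | exfalso].
  destruct (IVT_cor f a b Hf Hab) as [z [Hz Hfz]]; [nra |].
  exact (Hnz z Hz Hfz).
Qed.

Lemma continuous_pair {U V W : UniformSpace} (f : U -> V) (g : U -> W) (x : U) :
  continuous f x -> continuous g x ->
  continuous (U := prod_UniformSpace V W) (fun t => (f t, g t)) x.
Proof.
  intros Hf Hg.
  apply (continuous_comp_2 f g (fun a b => (a, b) : prod_UniformSpace V W) x Hf Hg).
  apply continuous_ext with (f := fun p => p).
  - intros [a b]; reflexivity.
  - apply continuous_id.
Qed.

Lemma continuity_root_path (r : R5 -> C) (a0 a1 a2 a3 a4 : R -> R) :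
  continuous_R5_C r ->
  continuity a0 -> continuity a1 -> continuity a2 -> continuity a3 ->
  continuity a4 ->
  continuity (fun t => Re (r (a0 t, a1 t, a2 t, a3 t, a4 t))) /\
  continuity (fun t => Im (r (a0 t, a1 t, a2 t, a3 t, a4 t))).
Proof.
  intros Hr H0 H1 H2 H3 H4.
  assert (Hc : forall t, continuous (U := C_UniformSpace)
                 (fun t => r (a0 t, a1 t, a2 t, a3 t, a4 t)) t).
  { intro t.
    apply (continuous_comp (V := R5_UniformSpace) (W := C_UniformSpace)
             (fun t => (a0 t, a1 t, a2 t, a3 t, a4 t)) r); [| apply Hr].
    repeat apply @continuous_pair; apply continuity_pt_filterlim; auto. }
  split; intro t; apply continuity_pt_filterlim.
  - apply (continuous_comp (V := C_UniformSpace) (W := R_UniformSpace)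
             (fun t => r (a0 t, a1 t, a2 t, a3 t, a4 t)) Re t (Hc t)).
    destruct (r (a0 t, a1 t, a2 t, a3 t, a4 t)) as [a b].
    exact (@continuous_fst R_UniformSpace R_UniformSpace a b).
  - apply (continuous_comp (V := C_UniformSpace) (W := R_UniformSpace)
             (fun t => r (a0 t, a1 t, a2 t, a3 t, a4 t)) Im t (Hc t)).
    destruct (r (a0 t, a1 t, a2 t, a3 t, a4 t)) as [a b].
    exact (@continuous_snd R_UniformSpace R_UniformSpace a b).
Qed.

(** * Roots of quintics given as products *)

Lemma Cmult_eq_0 (x y : C) : (x * y)%C = RtoC 0 -> x = RtoC 0 \/ y = RtoC 0.
Proof.
  intro H.
  destruct (Ceq_dec x 0) as [Hx | Hx]; [now left |].
  destruct (Ceq_dec y 0) as [Hy | Hy]; [now right |].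
  exfalso; exact (Cmult_neq_0 _ _ Hx Hy H).
Qed.

Lemma complex_quadratic_root (p q : C) (x : C) :
  (x * x + p * x + q)%C = RtoC 0 ->
  Re x * Re x - Im x * Im x + (Re p * Re x - Im p * Im x) + Re q = 0 /\
  2 * Re x * Im x + (Re p * Im x + Im p * Re x) + Im q = 0.
Proof.
  destruct x as [a b], p as [p1 p2], q as [q1 q2].
  unfold Cplus, Cmult, RtoC, Re, Im; simpl; intro H.
  injection H; intros; split; lra.
Qed.

Lemma F_factor (r : R5 -> C) (M : R5) (f g h : C) :
  continuous_root r -> F (R5_to_C5 M, r M) = (f * g * h)%C ->
  f = RtoC 0 \/ g = RtoC 0 \/ h = RtoC 0.
Proof.
  intros [_ Hr] H; rewrite Hr in H; symmetry in H.
  destruct (Cmult_eq_0 _ _ H) as [H' | H']; auto.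
  destruct (Cmult_eq_0 _ _ H') as [H'' | H'']; auto.
Qed.

Ltac expand_F :=
  match goal with |- F (_, ?z) = _ => destruct z as [a b] end;
  unfold F, R5_to_C5, Cplus, Cmult, Copp, RtoC; simpl;
  unfold Cmult; simpl; apply injective_projections; simpl.

(** The coefficients are those of [x ((x - 4i)^2 - 9 (c + is)) ((x + 4i)^2 - 9 (c - is))]; [sg]
    tells which quadratic factor vanishes. *)
Lemma circle_root (r : R5 -> C) (c s : R) :
  continuous_root r ->
  let x := r (0, (16 + 9 * c) * (16 + 9 * c) + 81 * (s * s), 144 * s,
              64 - 2 * (16 + 9 * c), 0) in
  (Re x = 0 /\ Im x = 0) \/
  exists sg, (sg = 1 \/ sg = -1) /\
    Re x * Re x - (Im x - 4 * sg) * (Im x - 4 * sg) = 9 * c /\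
    2 * Re x * (Im x - 4 * sg) = 9 * sg * s.
Proof.
  intros Hr; cbv zeta.
  set (M := (0, _, _, _, _)).
  destruct (F_factor r M (r M)
     (r M * r M + (0, -8)%R * r M + (-16 - 9 * c, - 9 * s)%R)%C
     (r M * r M + (0, 8)%R * r M + (-16 - 9 * c, 9 * s)%R)%C Hr) as [H | [H | H]].
  - subst M; expand_F; ring.
  - left; rewrite H; split; reflexivity.
  - right; exists 1; apply complex_quadratic_root in H; simpl in H.
    split; [now left | split; lra].
  - right; exists (-1); apply complex_quadratic_root in H; simpl in H.
    split; [now right | split; lra].
Qed.

(* [(X + iY)^2 = 9 (c + is)^2] makes [(X + iY) / (c + is)] equal to [3] or [-3],
   so its real part does not vanish. *)
Lemma square_root_projection_neq_0 (X Y c s : R) :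
  c * c + s * s = 1 ->
  X * X - Y * Y = 9 * (c * c - s * s) -> 2 * X * Y = 9 * (2 * s * c) ->
  X * c + Y * s <> 0.
Proof.
  intros Hcs H1 H2 H0.
  assert (E : (X * c + Y * s) * (X * c + Y * s) - (X * s - Y * c) * (X * s - Y * c)
              = 9 * ((c * c + s * s) * (c * c + s * s))).
  { transitivity ((X * X - Y * Y) * (c * c - s * s) + 2 * X * Y * (2 * s * c));
      [ring | rewrite H1, H2; ring]. }
  rewrite H0, Hcs in E; nra.
Qed.

(** The coefficients run through a loop, so [r] returns to its initial value. A nonzero root would
    be [4 sg i] plus a continuous square root, which changes sign over the loop. *)
Lemma central_root_zero (r : R5 -> C) :
  continuous_root r -> Re (r (0, 625, 0, 14, 0)) = 0 /\ Im (r (0, 625, 0, 14, 0)) = 0.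
Proof.
  intro Hr.
  destruct (continuity_root_path r (fun _ => 0)
    (fun t => (16 + 9 * cos t) * (16 + 9 * cos t) + 81 * (sin t * sin t))
    (fun t => 144 * sin t) (fun t => 64 - 2 * (16 + 9 * cos t)) (fun _ => 0))
    as [HRe HIm]; [apply Hr | reg .. |].
  set (X := fun t => Re (r _)) in HRe; set (Y := fun t => Im (r _)) in HIm.
  assert (E : forall t, cos t = 1 -> sin t = 0 ->
    X t = Re (r (0, 625, 0, 14, 0)) /\ Y t = Im (r (0, 625, 0, 14, 0))).
  { intros t Hc Hs; unfold X, Y; rewrite Hc, Hs.
    replace ((0, (16 + 9 * 1) * (16 + 9 * 1) + 81 * (0 * 0), 144 * 0,
              64 - 2 * (16 + 9 * 1), 0) : R5) with ((0, 625, 0, 14, 0) : R5);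
      [now split | apply R5_ext; ring]. }
  destruct (E 0 cos_0 sin_0) as [EX0 EY0].
  destruct (E (2 * PI) cos_2PI sin_2PI) as [EX1 EY1].
  assert (Hroot : forall t, (X t = 0 /\ Y t = 0) \/
    exists sg, (sg = 1 \/ sg = -1) /\
      X t * X t - (Y t - 4 * sg) * (Y t - 4 * sg) = 9 * cos t /\
      2 * X t * (Y t - 4 * sg) = 9 * sg * sin t).
  { intro t; exact (circle_root r (cos t) (sin t) Hr). }
  (* An upper root lies in the disc of radius 3 about [4i], a lower one about [-4i]. *)
  assert (Hdisc : forall t sg,
      X t * X t - (Y t - 4 * sg) * (Y t - 4 * sg) = 9 * cos t ->
      2 * X t * (Y t - 4 * sg) = 9 * sg * sin t -> (sg = 1 \/ sg = -1) ->
      -3 <= Y t - 4 * sg <= 3).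
  { intros t sg H1 H2 Hsg.
    (* With [w = x - 4 sg i] this is [|w|^4 = |w^2|^2 = 81]. *)
    assert (N : (X t * X t + (Y t - 4 * sg) * (Y t - 4 * sg)) *
                (X t * X t + (Y t - 4 * sg) * (Y t - 4 * sg)) = 81).
    { transitivity (81 * (sg * sg * Rsqr (sin t) + Rsqr (cos t))).
      - transitivity (Rsqr (X t * X t - (Y t - 4 * sg) * (Y t - 4 * sg)) +
                      Rsqr (2 * X t * (Y t - 4 * sg))); [unfold Rsqr; ring |].
        rewrite H1, H2; unfold Rsqr; ring.
      - replace (sg * sg) with 1 by (destruct Hsg; subst; ring).
        rewrite Rmult_1_l, sin2_cos2; ring. }
    assert (N9 : X t * X t + (Y t - 4 * sg) * (Y t - 4 * sg) <= 9) by nra.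
    assert (HX := Rle_0_sqr (X t)); unfold Rsqr in HX.
    nra. }
  rewrite <- EX0, <- EY0.
  destruct (Hroot 0) as [H | [sg [Hsg [H1 H2]]]]; [exact H | exfalso].
  assert (HY0 := Hdisc 0 sg H1 H2 Hsg).
  assert (Hpi := PI_RGT_0).
  (* By [Hdisc], [sg * Y] is at least 1 on the side of [sg], at most -1 on the other side, and 0 at
     the central root, so it never equals 1/2. *)
  assert (Hpos : forall t, 0 <= t -> 0 < sg * Y t - 1 / 2).
  { intros t Ht.
    apply (positive_of_nonvanishing (fun t => sg * Y t - 1 / 2) 0 t).
    - clearbody Y; reg.
    - exact Ht.
    - intros u _ Hu.
      destruct (Hroot u) as [[_ H] | [sg' [Hsg' [H1' H2']]]].
      + rewrite H in Hu; lra.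
      + assert (HY := Hdisc u sg' H1' H2' Hsg').
        destruct Hsg, Hsg'; subst; lra.
    - destruct Hsg; subst; lra. }
  (* [phi] is the real part of the followed square root divided by [exp (i t / 2)]. *)
  pose (phi := fun t => X t * cos (t / 2) + sg * (Y t - 4 * sg) * sin (t / 2)).
  assert (Hphi : continuity phi).
  { unfold phi; clearbody X Y; reg. }
  assert (Hphi0 : forall t, 0 <= t -> phi t <> 0).
  { intros t Ht; specialize (Hpos t Ht).
    destruct (Hroot t) as [[_ H] | [sg' [Hsg' [H1' H2']]]].
    { rewrite H in Hpos; lra. }
    assert (HY := Hdisc t sg' H1' H2' Hsg').
    assert (sg' = sg) by (destruct Hsg, Hsg'; subst; lra); subst sg'.
    assert (S1 : sg * sg = 1) by (destruct Hsg; subst; ring).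
    replace t with (2 * (t / 2)) in H1' at 5 by field.
    replace t with (2 * (t / 2)) in H2' at 3 by field.
    rewrite cos_2a in H1'; rewrite sin_2a in H2'.
    (* The factor [sg] on the imaginary part conjugates the lower case into the upper one, so both
       become square roots of [9 e^(it)]. *)
    apply square_root_projection_neq_0.
    - generalize (sin2_cos2 (t / 2)); unfold Rsqr; lra.
    - rewrite <- H1'.
      transitivity (X t * X t - sg * sg * ((Y t - 4 * sg) * (Y t - 4 * sg)));
        [ring | rewrite S1; ring].
    - transitivity (sg * (2 * X t * (Y t - 4 * sg))); [ring |].
      rewrite H2'.
      transitivity (sg * sg * (9 * (2 * sin (t / 2) * cos (t / 2)))); [ring |].
      rewrite S1; ring. }
  assert (P0 : phi 0 = X 0).
  { unfold phi; replace (0 / 2) with 0 by field; rewrite cos_0, sin_0; ring. }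
  assert (P1 : phi (2 * PI) = - X 0).
  { unfold phi; replace (2 * PI / 2) with PI by field; rewrite cos_PI, sin_PI.
    rewrite EX0, EX1; ring. }
  destruct (IVT_cor phi 0 (2 * PI) Hphi) as [z [Hz Hz0]]; [lra | |].
  - rewrite P0, P1; nra.
  - apply (Hphi0 z); [lra | exact Hz0].
Qed.

(** * Paths of quintics with a real root and two real quadratic factors *)

(** The coefficients are those of [(x - y) (x^2 + p x + q) (x^2 + p' x + q')]. *)
Lemma real_quadratics_root (r : R5 -> C) (p q p' q' y : R) :
  continuous_root r ->
  let x := r (- y * (q * q'), q * q' - y * (p * q' + p' * q),
              p * q' + p' * q - y * (q + q' + p * p'),
              q + q' + p * p' - y * (p + p'), p + p' - y) in
  (Re x = y /\ Im x = 0) \/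
  (Re x * Re x - Im x * Im x + p * Re x + q = 0 /\ (2 * Re x + p) * Im x = 0) \/
  (Re x * Re x - Im x * Im x + p' * Re x + q' = 0 /\ (2 * Re x + p') * Im x = 0).
Proof.
  intros Hr; cbv zeta.
  set (M := (_, _, _, _, _)).
  destruct (F_factor r M (r M - RtoC y)%C
     (r M * r M + RtoC p * r M + RtoC q)%C
     (r M * r M + RtoC p' * r M + RtoC q')%C Hr) as [H | [H | H]].
  - subst M; unfold Cminus; expand_F; ring.
  - left; destruct (r M) as [a b]; unfold Cminus, Cplus, Copp, RtoC in H; simpl in H.
    injection H; simpl; intros; split; lra.
  - right; left; apply complex_quadratic_root in H; simpl in H; split; lra.
  - right; right; apply complex_quadratic_root in H; simpl in H; split; lra.
Qed.

(* The pair [-3 sg +- 4 i] moves to the real roots [-4 sg], [-2 sg]. *)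
Lemma root_zero_after_collision (r : R5 -> C) (sg : R) :
  continuous_root r -> (sg = 1 \/ sg = -1) ->
  Re (r (0, 200, 102 * sg, -3, 0)) = 0.
Proof.
  intros Hr Hsg.
  assert (S1 : sg * sg = 1) by (destruct Hsg; subst; ring).
  destruct (central_root_zero r Hr) as [HRe0 _].
  (* The quintic is [x (x^2 - 6 sg x + 25) (x^2 + 6 sg x + 25 - t)]: the last pair collides at
     [t = 16] and reaches [-4 sg], [-2 sg] at [t = 17]. *)
  destruct (continuity_root_path r (fun _ => 0) (fun t => 25 * (25 - t))
     (fun t => 6 * sg * t) (fun t => 14 - t) (fun _ => 0)) as [HRe _];
    [apply Hr | reg .. |].
  set (X := fun t => Re (r _)) in HRe.
  assert (E0 : X 0 = 0).
  { refine (eq_trans _ HRe0); apply (f_equal (fun M => Re (r M))), R5_ext; ring. }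
  assert (E1 : Re (r (0, 200, 102 * sg, -3, 0)) = X 17).
  { unfold X; apply (f_equal (fun M => Re (r M))), R5_ext; ring. }
  assert (Hroot : forall t, 0 <= t <= 17 ->
    X t = 0 \/ sg * X t = 3 \/ -4 <= sg * X t <= -2).
  { intros t Ht.
    assert (H := real_quadratics_root r (-6 * sg) 25 (6 * sg) (25 - t) 0 Hr).
    cbv zeta in H.
    set (M := (_, _, _, _, _)) in H.
    assert (HM : M = (0, 25 * (25 - t), 6 * sg * t, 14 - t, 0)).
    { subst M; apply R5_ext; try ring.
      transitivity (50 - t - 36 * (sg * sg)); [ring | rewrite S1; ring]. }
    rewrite HM in H; change (Re (r _)) with (X t) in H.
    set (Y := Im _) in H.
    destruct H as [H | [[H H'] | [H H']]].
    - left; lra.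
    - destruct (Rmult_integral _ _ H') as [HY | HY].
      + right; left; destruct Hsg; subst; lra.
      + exfalso; rewrite HY in H; destruct Hsg; subst; nra.
    - right; right.
      destruct (Rmult_integral _ _ H') as [HY | HY].
      + destruct Hsg; subst; lra.
      + rewrite HY in H; destruct Hsg; subst; nra. }
  rewrite E1.
  (* The values -1 and 1 of [sg * X] separate 0 from the other two alternatives of [Hroot]. *)
  assert (L : 0 < sg * X 17 + 1).
  { apply (positive_of_nonvanishing (fun t => sg * X t + 1) 0 17); [| lra | | rewrite E0; lra].
    - clearbody X; reg.
    - intros t Ht H0; destruct (Hroot t Ht) as [H | [H | H]]; [rewrite H in H0 |..]; lra. }
  assert (U : 0 < 1 - sg * X 17).
  { apply (positive_of_nonvanishing (fun t => 1 - sg * X t) 0 17); [| lra | | rewrite E0; lra].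
    - clearbody X; reg.
    - intros t Ht H0; destruct (Hroot t Ht) as [H | [H | H]]; [rewrite H in H0 |..]; lra. }
  destruct (Hroot 17) as [H | [H | H]]; lra.
Qed.

(* Along the last path the roots are [y], [y - 2], [y - 4] and [u +- 4 i], where
   [u = 3 - 3 y / 2], for [y] from [0] to [4]. *)
Theorem mainTheorem5 :
  ~ exists r : R5 -> C,
      continuous_R5_C r /\
      forall M : R5, F (R5_to_C5 M, r M) = RtoC 0.
Proof.
  intros [r Hr]; change (continuous_root r) in Hr.
  assert (HL := root_zero_after_collision r 1 Hr (or_introl eq_refl)).
  assert (HR := root_zero_after_collision r (-1) Hr (or_intror eq_refl)).
  (* Since [u] goes from 3 to -3, the quintics at [y = 0] and [y = 4] are those of [HL] and [HR]. *)
  pose (p := fun y => 6 - 2 * y).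
  pose (q := fun y => (y - 2) * (y - 4)).
  pose (p' := fun y => 3 * y - 6).
  pose (q' := fun y => (3 - 3 * y / 2) * (3 - 3 * y / 2) + 16).
  destruct (continuity_root_path r (fun y => - y * (q y * q' y))
     (fun y => q y * q' y - y * (p y * q' y + p' y * q y))
     (fun y => p y * q' y + p' y * q y - y * (q y + q' y + p y * p' y))
     (fun y => q y + q' y + p y * p' y - y * (p y + p' y))
     (fun y => p y + p' y - y)) as [HRe HIm];
    [apply Hr | unfold p, q, p', q'; reg .. |].
  set (X := fun t => Re (r _)) in HRe; set (Y := fun t => Im (r _)) in HIm.
  assert (E0 : X 0 = 0).
  { refine (eq_trans _ HL); apply (f_equal (fun M => Re (r M))), R5_ext; unfold p, q, p', q'; field. }
  assert (E1 : X 4 = 0).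
  { refine (eq_trans _ HR); apply (f_equal (fun M => Re (r M))), R5_ext; unfold p, q, p', q'; field. }
  assert (Hroot : forall y,
    (Y y = 0 /\ (X y = y \/ X y = y - 2 \/ X y = y - 4)) \/
    ((Y y = 4 \/ Y y = -4) /\ X y = 3 - 3 * y / 2)).
  { intro y; assert (H := real_quadratics_root r (p y) (q y) (p' y) (q' y) y Hr).
    cbv zeta in H; change (Re (r _)) with (X y) in H; change (Im (r _)) with (Y y) in H.
    unfold p, q, p', q' in H.
    destruct H as [H | [[H H'] | [H H']]].
    - tauto.
    (* Otherwise [X y = y - 3], and the real part gives [Y^2 = -1]. *)
    - assert (HY : Y y = 0).
      { destruct (Rmult_integral _ _ H') as [HX | HX]; nra. }
      left; split; [exact HY | right].
      rewrite HY in H.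
      assert (HX : (X y - (y - 2)) * (X y - (y - 4)) = 0) by nra.
      destruct (Rmult_integral _ _ HX); [left | right]; lra.
    - right.
      destruct (Rmult_integral _ _ H') as [HX | HX].
      + assert (HX' : X y = 3 - 3 * y / 2) by lra.
        split; [| exact HX'].
        assert (HY : (Y y - 4) * (Y y + 4) = 0) by (rewrite HX' in H; nra).
        destruct (Rmult_integral _ _ HY); [left | right]; lra.
      + exfalso; rewrite HX in H.
        assert (0 <= (X y - (3 - 3 * y / 2)) * (X y - (3 - 3 * y / 2)))
          by apply Rle_0_sqr.
        nra. }
  assert (HY0 : Y 0 = 0).
  { destruct (Hroot 0) as [[H _] | [_ H]]; [exact H | rewrite E0 in H; lra]. }
  assert (HY : forall y, 0 <= y -> Y y = 0).
  { intros y Hy.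
    (* Imaginary parts of roots are 0, 4 or -4, so [Y] crosses neither -2 nor 2 and the followed
       root stays real. *)
    assert (L : 0 < Y y + 2).
    { apply (positive_of_nonvanishing (fun y => Y y + 2) 0 y);
        [clearbody Y; reg | exact Hy | | rewrite HY0; lra].
      intros t _ H; destruct (Hroot t) as [[H' _] | [[H' | H'] _]]; lra. }
    assert (U : 0 < 2 - Y y).
    { apply (positive_of_nonvanishing (fun y => 2 - Y y) 0 y);
        [clearbody Y; reg | exact Hy | | rewrite HY0; lra].
      intros t _ H; destruct (Hroot t) as [[H' _] | [[H' | H'] _]]; lra. }
    destruct (Hroot y) as [[H _] | [[H | H] _]]; lra. }
  (* The line [y - 1] lies strictly between the two largest real roots. The followed root starts
     above it, so [X 4 > 3], contradicting [E1]. *)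
  assert (T : 0 < X 4 - (4 - 1)).
  { apply (positive_of_nonvanishing (fun y => X y - (y - 1)) 0 4);
      [clearbody X; reg | lra | | rewrite E0; lra].
    intros y Hy H; specialize (HY y (proj1 Hy)).
    destruct (Hroot y) as [[_ H'] | [[H' | H'] _]]; lra. }
  lra.
Qed.
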